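(* TD(0) is in general biased for cyclic Markov Reward Processes: consider the Markov Reward Process with states $1,2$, starting state $1$, terminal state $2$, transitions $1\to1$ with probability $p\in(0,1)$ and reward $1$, and $1\to2$ with probability $1-p$ and reward $0$, discount $\gamma=1$, and one observed path ($n=1$). Then the TD(0) estimator $\bar V_1$ of the value $V_1$ of state $1$, with learning rates $\alpha_j=1/j$, is biased: $\mathbb E[\bar V_1]\neq V_1$.
   Context: The value $V_1$ is the expected total reward collected from state $1$ until termination, $V_1=p/(1-p)$. TD(0): the estimate of state $1$ is initialized with $0$ and the value estimate of the terminal state is $0$; at the $j$-th transition $1\to s'$ of the path, with reward $R$, the estimate is updated by $\bar V_1\leftarrow\bar V_1+\alpha_j(R+\gamma\bar V_{s'}-\bar V_1)$. $\bar V_1$ denotes the estimate after the complete path has been processed. *)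

(* Defs.v *)
From HB Require Import structures.
From mathcomp Require Import all_boot all_order all_algebra.
From mathcomp Require Import all_classical all_reals all_analysis.

Set Implicit Arguments.
Unset Strict Implicit.
Unset Printing Implicit Defensive.

Import Order.TTheory GRing.Theory Num.Theory.
Local Open Scope classical_set_scope.
Local Open Scope ring_scope.

(* A path stops at its first visit to [terminal]; the row [trans terminal] and
   the rewards [reward terminal _] are never used. *)
Record MRP (R : realType) := {
  state :> finType;
  start : state;
  terminal : state;
  trans : state -> state -> R;
  reward : state -> state -> R;
  discount : R;
  trans_ge0 : forall x y, 0 <= trans x y;
  trans_sum1 : forall x, \sum_y trans x y = 1
}.

(* The law of X is prescribed only up to the first visit to the terminal state:
   every finite sequence x_0, ..., x_n with x_0, ..., x_(n-1) nonterminal is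
   followed with probability 1_(x_0 = start) * \prod_(i < n) trans x_i x_(i+1).
   The values of X after termination are arbitrary. *)
Definition is_run (R : realType) (M : MRP R) (d : measure_display)
    (T : measurableType d) (P : probability T R) (X : nat -> T -> M) : Prop :=
  (forall n (x : M), measurable [set w | X n w = x]) /\
  (forall (n : nat) (x : nat -> M),
     (forall i, (i < n)%N -> x i != terminal M) ->
     P [set w | forall i, (i <= n)%N -> X i w = x i] =
       ((x 0%N == start M)%:R * \prod_(i < n) trans (x i) (x i.+1))%:E).

(* The path [:: x 0; ...; x tau], tau being the first visit to the terminal
   state; by convention [::] if the terminal state is never visited. *)
Definition episode (R : realType) (M : MRP R) (x : nat -> M) : seq M :=
  match pselect (exists n, x n == terminal M) with
  | left h => mkseq x (ex_minn h).+1
  | right _ => [::]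
  end.

Fixpoint return_from (R : realType) (M : MRP R) (x : M) (s : seq M) : R :=
  if s is y :: s' then reward x y + discount M * return_from y s' else 0.

Definition path_return (R : realType) (M : MRP R) (s : seq M) : R :=
  if s is x :: s' then return_from x s' else 0.

Definition value_start (R : realType) (M : MRP R) (d : measure_display)
    (T : measurableType d) (P : probability T R) (X : nat -> T -> M) : \bar R :=
  'E_P[(fun w => path_return (episode (X ^~ w)))].

(* [V] holds the current estimates and [N z] the number of transitions out of
   [z] processed so far, so that the j-th transition out of a state is
   processed with learning rate [alpha j], j >= 1. *)
Fixpoint td0_from (R : realType) (M : MRP R) (alpha : nat -> R)
    (V : M -> R) (N : M -> nat) (x : M) (s : seq M) : M -> R :=
  if s is y :: s' then
    td0_from alpha
      (fun z => if z == x
                then V x + alpha (N x).+1 * (reward x y + discount M * V y - V x)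
                else V z)
      (fun z => if z == x then (N x).+1 else N z)
      y s'
  else V.

Definition td0 (R : realType) (M : MRP R) (alpha : nat -> R) (s : seq M) :
    M -> R :=
  if s is x :: s' then td0_from alpha (fun=> 0) (fun=> 0%N) x s' else fun=> 0.

Inductive two_states := St1 | St2.

Definition bool_of_two_states (s : two_states) : bool :=
  if s is St1 then false else true.
Definition two_states_of_bool (b : bool) : two_states :=
  if b then St2 else St1.
Lemma bool_of_two_statesK : cancel bool_of_two_states two_states_of_bool.
Proof. by case. Qed.

HB.instance Definition _ := Finite.copy two_states (can_type bool_of_two_statesK).

Definition cyclic_trans (R : realType) (p : R) (x y : two_states) : R :=
  match x, y with
  | St1, St1 => p
  | St1, St2 => 1 - p
  | St2, St1 => 0
  | St2, St2 => 1
  end.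

Definition cyclic_reward (R : realType) (x y : two_states) : R :=
  match x, y with
  | St1, St1 => 1
  | _, _ => 0
  end.

Lemma cyclic_trans_ge0 (R : realType) (p : R) (hp : 0 < p < 1) x y :
  0 <= cyclic_trans p x y.
Proof.
by case/andP: hp => p0 p1; case: x; case: y => //=; rewrite ?subr_ge0 ltW.
Qed.

Lemma cyclic_trans_sum1 (R : realType) (p : R) (x : two_states) :
  \sum_y cyclic_trans p x y = 1.
Proof.
rewrite (reindex two_states_of_bool) /=; last first.
  by exists bool_of_two_states; case.
by rewrite big_bool /=; case: x => /=; rewrite ?subrK ?addr0.
Qed.

Definition cyclic_MRP (R : realType) (p : R) (hp : 0 < p < 1) : MRP R :=
  {| state := two_states;
     start := St1;
     terminal := St2;
     trans := cyclic_trans p;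
     reward := @cyclic_reward R;
     discount := 1;
     trans_ge0 := cyclic_trans_ge0 hp;
     trans_sum1 := cyclic_trans_sum1 p |}.

(* Main.v *)
(** An episode making [k] loops before terminating returns [k], and has
    probability [p ^+ k * (1 - p)]. On it TD(0) with rates [1/j] reaches the
    harmonic number [H_k] after the loops, and the last, unrewarded transition
    multiplies this by [1 - 1/(k+1)]. This never exceeds [k], and is smaller
    than [k] already for [k = 1], so that the expectation of the estimate is
    strictly below that of the return, which is finite. *)
Require Import Defs.
From mathcomp Require Import all_boot all_order all_algebra.
From mathcomp Require Import all_classical all_reals all_analysis.
From mathcomp Require Import measurable_realfun ring.

Set Implicit Arguments.
Unset Strict Implicit.
Unset Printing Implicit Defensive.

Import Order.TTheory GRing.Theory Num.Theory.
Import numFieldNormedType.Exports.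
Local Open Scope classical_set_scope.
Local Open Scope ring_scope.

(** Induction gives a closed form of the partial sums: [p / (1 - p)] minus a nonnegative remainder.
    Hence they are bounded, so they converge, and this in turn makes the remainder vanish. *)
Lemma geometric_mean_cvg (R : realType) (p : R) : 0 < p < 1 ->
  series (fun k => k%:R * (p ^+ k * (1 - p)) : R) @ \oo --> p / (1 - p).
Proof.
move=> /andP[p0 p1]; have q0 : 1 - p != 0 by rewrite subr_eq0 gt_eqF.
pose u k : R := k%:R * (p ^+ k * (1 - p)).
have u0 k : 0 <= u k.
  by rewrite !mulr_ge0 ?ler0n ?exprn_ge0 ?subr_ge0 ?ltW.
have seriesE n :
    series u n = p / (1 - p) - ((1 - p)^-1 * u n + p / (1 - p) * p ^+ n).
  elim: n => [|n IHn]; first by rewrite /series /= big_geq // /u expr0; field.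
  by rewrite seriesSr IHn /u exprS -natr1; field.
have cu : cvgn (series u).
  have qV_ge0 : 0 <= (1 - p)^-1 by rewrite invr_ge0 subr_ge0 ltW.
  apply: (@nondecreasing_is_cvgn R (series u)).
    by apply: nondecreasing_series => i _ _; exact: u0.
  exists (p / (1 - p)) => _ [n _ <-].
  rewrite seriesE gerBl addr_ge0 ?(mulr_ge0 qV_ge0 (u0 n)) //.
  by rewrite !mulr_ge0 ?exprn_ge0 // ltW.
have -> : series (fun k => k%:R * (p ^+ k * (1 - p))) =
    (fun n => p / (1 - p) - ((1 - p)^-1 * u n + p / (1 - p) * p ^+ n)).
  by apply/funext.
(* [u n --> 0] comes for free: it is the general term of a convergent series. *)
have cuM : (1 - p)^-1 * u n @[n --> \oo] --> (1 - p)^-1 * 0.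
  by apply: cvgM; [exact: cvg_cst|exact: cvg_series_cvg_0].
have cpM : p / (1 - p) * p ^+ n @[n --> \oo] --> p / (1 - p) * 0.
  apply: cvgM; first exact: cvg_cst.
  by apply: cvg_expr; rewrite ger0_norm ?ltW.
have := cvgB (cvg_cst (p / (1 - p))) (cvgD cuM cpM).
by rewrite !mulr0 addr0 subr0; apply.
Qed.

Lemma eseries_delta (R : realType) (f : nat -> \bar R) (k : nat) :
  (0 <= f k)%E -> (forall i, i != k -> f i = 0%E) ->
  (\sum_(0 <= i <oo) f i = f k)%E.
Proof.
move=> fk0 f0; rewrite (@nneseriesD1 _ _ k) // ?eseries0 ?adde0 //.
  by move=> i _ /= /f0.
by move=> i _; have [->//|/f0->] := eqVneq i k.
Qed.

Section CyclicEpisodes.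
Context {R : realType} {p : R} {hp : 0 < p < 1}.
Local Notation M := (cyclic_MRP hp).
Let s1 : M := St1.
Let s2 : M := St2.

(** Making [k] loops means visiting [s1] at the [k.+1] times [0, ..., k]. *)
Definition loop_episode (k : nat) : seq M := rcons (nseq k.+1 s1) s2.

Definition loop_path (k : nat) : nat -> M :=
  fun i => if (i <= k)%N then s1 else s2.

Lemma loop_pathE (k : nat) (x : nat -> M) :
  (forall i, (i <= k.+1)%N -> x i = loop_path k i) ->
  episode x = loop_episode k.
Proof.
move=> xE; rewrite /episode; case: pselect => [h|[]]; last first.
  by exists k.+1; rewrite xE // /loop_path ltnn.
case: ex_minnP => m /eqP xm minm.
have mk : (m <= k.+1)%N by apply: minm; rewrite xE // /loop_path ltnn.
have -> : m = k.+1.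
  apply/eqP; rewrite eqn_leq mk /= leqNgt; apply/negP => mk'.
  by move: xm; rewrite xE // /loop_path -ltnS mk'.
rewrite /loop_episode mkseqS; congr rcons; last first.
  by rewrite xE // /loop_path ltnn.
apply: (@eq_from_nth _ s1); rewrite size_mkseq ?size_nseq // => i ik.
by rewrite nth_mkseq // nth_nseq ik xE ?(ltnW ik) // /loop_path -ltnS ik.
Qed.

(** The cases are: no termination, start in [s2], first visit to [s2] at time [k.+1]. In the last
    one, minimality leaves only [s1] for the earlier states. *)
Lemma episode_cases (x : nat -> M) :
  [\/ episode x = [::], episode x = [:: s2] |
      exists k, forall i, (i <= k.+1)%N -> x i = loop_path k i].
Proof.
rewrite /episode; case: pselect => [h|]; last by constructor 1.
case: ex_minnP => -[|k] /eqP xk minx; first by constructor 2; rewrite /mkseq /= xk.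
constructor 3; exists k => i; rewrite leq_eqVlt /loop_path => /predU1P[->|ik].
  by rewrite ltnn xk.
rewrite -ltnS ik; case xi: (x i) => //.
by have := minx i; rewrite xi => /(_ isT); rewrite leqNgt ik.
Qed.

Lemma path_return_loop_episode (k : nat) :
  path_return (loop_episode k) = k%:R.
Proof.
rewrite /path_return /loop_episode /=.
elim: k => [|k IHk] /=; first by rewrite mulr0 addr0.
by rewrite IHk mul1r -natr1 addrC.
Qed.

(** In a loop the bootstrap term cancels the old estimate, so the update just adds the learning
    rate; the exit, with target [0], multiplies by one minus the rate. [V] and [N] are general
    because each loop changes both. *)
Lemma td0_from_loops (k : nat) (V : M -> R) (N : M -> nat) : V s2 = 0 ->
  td0_from (fun j => j%:R^-1) V N s1 (rcons (nseq k s1) s2) s1 =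
  (V s1 + \sum_(i < k) (N s1 + i).+1%:R^-1) * (1 - (N s1 + k).+1%:R^-1).
Proof.
elim: k V N => [|k IHk] V N V2 /=.
  by rewrite V2 big_ord0 addn0 !mulr0 !addr0; ring.
rewrite IHk //= big_ord_recl addn0 addSnnS.
congr (_ * _); rewrite mul1r addrA; congr (_ + _); first by ring.
by apply: eq_bigr => i _; rewrite addSnnS.
Qed.

Lemma td0_loop_episode (k : nat) :
  td0 (fun j => j%:R^-1) (loop_episode k) s1 =
  (\sum_(i < k) i.+1%:R^-1) * (1 - k.+1%:R^-1).
Proof. by rewrite [LHS]td0_from_loops // add0r. Qed.

Lemma td0_loop_episode_ge0 (k : nat) :
  0 <= td0 (fun j => j%:R^-1) (loop_episode k) s1.
Proof.
rewrite td0_loop_episode mulr_ge0 ?sumr_ge0 ?subr_ge0 //.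
by rewrite invf_le1 ?ltr0n // ler1n.
Qed.

(** Each of the [k] harmonic terms is at most [1], and so is the final factor. *)
Lemma td0_loop_episode_le (k : nat) :
  td0 (fun j => j%:R^-1) (loop_episode k) s1 <= k%:R.
Proof.
rewrite td0_loop_episode -[leRHS]mulr1 ler_pM ?sumr_ge0 ?subr_ge0 //.
- by rewrite invf_le1 ?ltr0n // ler1n.
- apply: (@le_trans _ _ (\sum_(i < k) 1)); last by rewrite sumr_const card_ord.
  by apply: ler_sum => i _; rewrite invf_le1 ?ltr0n // ler1n.
Qed.

Context {d : measure_display} {T : measurableType d} {P : probability T R}
  {X : nat -> T -> M} (hX : is_run P X).

Let loop_event k := [set w | forall i, (i <= k.+1)%N -> X i w = loop_path k i].

Lemma measurable_loop_event k : measurable (loop_event k).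
Proof.
rewrite (_ : loop_event k =
    \bigcap_(i in [set i | (i <= k.+1)%N]) [set w | X i w = loop_path k i]) //.
by apply: bigcap_measurable => [|i _]; [exists 0%N|exact: hX.1].
Qed.

Lemma loop_event_prob k : P (loop_event k) = (p ^+ k * (1 - p))%:E.
Proof.
rewrite [LHS]hX.2; last by move=> i; rewrite ltnS /loop_path => ->.
rewrite /loop_path /= mul1r big_ord_recr /= leqnn ltnn; congr (_ * _)%:E.
rewrite (eq_bigr (fun=> p)) ?prodr_const ?card_ord // => i _.
by rewrite ltn_ord ltnW.
Qed.

(* The hypotheses on [phi] make it vanish outside the loop events, hence also on
   the null sets where [X] starts in [s2] or never terminates. *)
Lemma expectation_episode (phi : seq M -> R) :
  phi [::] = 0 -> phi [:: s2] = 0 -> (forall k, 0 <= phi (loop_episode k)) ->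
  ('E_P[(fun w => phi (episode (X ^~ w)))%R] =
   \sum_(0 <= k <oo) (phi (loop_episode k) * (p ^+ k * (1 - p)))%:E)%E.
Proof.
move=> phi0 phi2 phi_ge0; rewrite unlock.
(* The loop events are disjoint, so at most one term of the series is nonzero at [w]. *)
have phiE w : (phi (episode (X ^~ w)))%:E = (\sum_(0 <= k <oo)
    ((phi (loop_episode k))%:E * (\1_(loop_event k) w)%:E))%E.
  have [[k wk]|noloop] := pselect (exists k, loop_event k w).
    rewrite (@eseries_delta _ _ k) => [||i ik].
    - by rewrite indicE mem_set //= mule1 (loop_pathE wk).
    - by rewrite mule_ge0 // lee_fin.
    rewrite indicE memNset ?mule0 // => wi.
    (* One step after the smaller of the two indices, one path is already in [s2] and the other
       still in [s1]. *)
    have [lt_ik|] := ltnP i k.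
      have := wi i.+1 (leqnn _); rewrite wk; last exact: leqW.
      by rewrite /loop_path lt_ik ltnn.
    rewrite leq_eqVlt eq_sym (negPf ik) /= => lt_ki.
    have := wk k.+1 (leqnn _); rewrite wi; last exact: leqW.
    by rewrite /loop_path lt_ki ltnn.
  rewrite eseries0 => [|k _ _]; last first.
    by rewrite indicE memNset ?mule0 // => wk; apply: noloop; exists k.
  by case: (episode_cases (X ^~ w)) => [->|->|//]; rewrite ?phi0 ?phi2.
under eq_integral do rewrite phiE.
rewrite integral_nneseries //; last 2 first.
- move=> k; apply: measurable_funeM; apply/measurable_EFinP.
  exact/measurable_indic/measurable_loop_event.
- by move=> k w _; rewrite mule_ge0 // lee_fin.
apply: eq_eseriesr => k _.
rewrite ge0_integralZl //; last 2 first.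
- exact/measurable_EFinP/measurable_indic/measurable_loop_event.
- exact: phi_ge0.
rewrite integral_indic //; last exact: measurable_loop_event.
by rewrite setIT EFinM; congr (_ * _)%E; exact: loop_event_prob.
Qed.

End CyclicEpisodes.

Theorem mainTheorem20 (R : realType) (p : R) (hp : 0 < p < 1)
    (d : measure_display) (T : measurableType d) (P : probability T R)
    (X : nat -> T -> cyclic_MRP hp) (hX : is_run P X) :
  value_start P X = (p / (1 - p))%:E /\
  ('E_P[(fun w => td0 (fun j => j%:R^-1) (episode (X ^~ w))
                    (St1 : cyclic_MRP hp))%R])%E
    <> value_start P X.
Proof.
have /andP[p0 p1] := hp.
have pk_ge0 k : 0 <= p ^+ k * (1 - p).
  by rewrite mulr_ge0 ?exprn_ge0 ?subr_ge0 ?ltW.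
have VE : value_start P X = (\sum_(0 <= k <oo) (k%:R * (p ^+ k * (1 - p)))%:E)%E.
  rewrite /value_start (expectation_episode hX) => // [|k].
    by apply: eq_eseriesr => k _; rewrite path_return_loop_episode.
  by rewrite path_return_loop_episode.
have V1 : value_start P X = (p / (1 - p))%:E.
  rewrite VE; apply/cvg_lim => //.
  rewrite (_ : (fun _ => _) =
      EFin \o series (fun k => k%:R * (p ^+ k * (1 - p)) : R)); last first.
    by apply/funext => n; rewrite /= sumEFin.
  by apply/cvg_EFin; [exact: nearW|exact: geometric_mean_cvg].
split=> //.
pose td k : R := td0 (fun j => j%:R^-1) (loop_episode (hp := hp) k) (St1 : cyclic_MRP hp).
have -> : ('E_P[(fun w => td0 (fun j => j%:R^-1) (episode (X ^~ w))
    (St1 : cyclic_MRP hp))%R] = \sum_(0 <= k <oo) (td k * (p ^+ k * (1 - p)))%:E)%E.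
  by apply: (expectation_episode hX
    (phi := fun s => td0 (fun j => j%:R^-1) s (St1 : cyclic_MRP hp))) => // k;
    exact: td0_loop_episode_ge0.
set S := (\sum_(0 <= k <oo) (td k * _)%:E)%E.
(* Strictness is obtained by splitting the value as [S] plus a series of nonnegative gaps with
   positive sum. *)
pose gap k := (k%:R - td k) * (p ^+ k * (1 - p)).
have gap_ge0 k : (0 <= (gap k)%:E)%E.
  by rewrite lee_fin mulr_ge0 // subr_ge0 td0_loop_episode_le.
have VS : (value_start P X = S + \sum_(0 <= k <oo) (gap k)%:E)%E.
  rewrite VE -nneseriesD //; last first.
    by move=> k _ _; rewrite lee_fin mulr_ge0 ?td0_loop_episode_ge0.
  apply: eq_eseriesr => k _; rewrite -EFinD; congr _%:E.
  by rewrite /gap; ring.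
have gap1 : (0 < \sum_(0 <= k <oo) (gap k)%:E)%E.
  (* Two terms suffice: [td 1 = 1 - 1/2], so [gap 1] is positive. *)
  apply: lt_le_trans (nneseries_lim_ge 2 _) => //.
  rewrite big_nat_recr //= big_nat1 -EFinD lte_fin ltr_wpDl //.
    exact: gap_ge0 0%N.
  rewrite /gap /td td0_loop_episode big_ord1 !mulr_gt0 ?exprn_gt0 ?subr_gt0 //.
  by rewrite invr1 mul1r gtrBl invr_gt0 ltr0n.
(* Cancelling [S] in the extended reals requires it to be finite; equality with the value would
   provide this. *)
move=> SV; have S_fin : S \is a fin_num by rewrite SV V1.
by move: gap1; rewrite -(lteDl _ S_fin) -VS SV ltxx.
Qed.
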